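(* Let $G$ be a group that contains a subgroup isomorphic either to a finite noncyclic group or to a free product $C_q * C_r$, where $q, r$ are positive integers or $\infty$ and $1 < \min(q, r) < \infty$. Then the integral group ring $\mathbb{Z}[G]$ of $G$ has a nontrivial pair of zero-divisors.
   Context: $C_n$ denotes a cyclic group of order $n$, where $n = \infty$ is allowed ($C_\infty$ is the infinite cyclic group). For a group $G$, $\mathbb{Z}[G]$ denotes the integral group ring of $G$. A pair of zero-divisors in $\mathbb{Z}[G]$ is a pair $A, B \in \mathbb{Z}[G]$ with $A \neq 0$, $B \neq 0$ and $AB = 0$. Such a pair is called trivial if there are $X, Y \in \mathbb{Z}[G]$ and an element $h \in G$ of finite order $s > 1$ such that either $A = X(1-h)$ and $B = (1 + h + \dots + h^{s-1})Y$, or $A = X(1 + h + \dots + h^{s-1})$ and $B = (1-h)Y$. A pair of zero-divisors is nontrivial if it is not trivial. *)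

(* Defs.v *)
From HB Require Import structures.
From mathcomp Require Import all_boot all_order all_algebra all_fingroup.
From mathcomp Require Import all_solvable.
From mathcomp Require Import finmap.
From mathcomp.multinomials Require Import monalg.

Set Implicit Arguments.
Unset Strict Implicit.
Unset Printing Implicit Defensive.

Import GRing.Theory.

Local Open Scope ring_scope.

(* Finitely supported functions G -> int with convolution. The ring instance
   that monalg puts on {malg int[K]} requires K to have no nontrivial unit, so
   it never applies to a group; hence the alias with its own ring structure. *)
Definition zgroup_ring (G : groupType) : Type := {malg int[G]}.

HB.instance Definition _ (G : groupType) :=
  GRing.Zmodule.copy (zgroup_ring G) {malg int[G]}.

Section GroupRing.
Variable G : groupType.
Local Notation ZG := (zgroup_ring G).
Implicit Types (a b c : ZG) (g h : G).

Definition zgelt g : ZG := mkmalgU g (1 : int).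

Definition zgone : ZG := zgelt 1%g.

Definition zgmul a b : ZG :=
  \sum_(g <- msupp a) \sum_(h <- msupp b)
    (mkmalgU (g * h)%g (mcoeff g a * mcoeff h b) : ZG).

Let U g (x : int) : ZG := mkmalgU g x.

Let UD g : {morph U g : x y / x + y}.
Proof. by move=> x y; rewrite /U monalgUD. Qed.

Let U0 g : U g 0 = 0. Proof. by rewrite /U monalgU0. Qed.

Let mcD g a b : mcoeff g (a + b) = mcoeff g a + mcoeff g b.
Proof. exact: mcoeffD. Qed.

Let zgE a : a = \sum_(g <- msupp a) U g (mcoeff g a).
Proof. exact: monalgE. Qed.

Lemma zgmulw (d1 d2 : {fset G}) a b :
  (msupp a `<=` d1)%fset -> (msupp b `<=` d2)%fset ->
  zgmul a b = \sum_(g <- d1) \sum_(h <- d2)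
    (mkmalgU (g * h)%g (mcoeff g a * mcoeff h b) : ZG).
Proof.
move=> le1 le2; rewrite /zgmul (big_fset_incl _ le1) /=.
  apply/eq_bigr=> g _; apply/big_fset_incl => // h _ /mcoeff_outdom ->.
  by rewrite mulr0 -/(U _ _) U0.
move=> g _ /mcoeff_outdom e.
by rewrite big1 // => h _; rewrite e mul0r -/(U _ _) U0.
Qed.

Let zgmulDl : left_distributive zgmul +%R.
Proof.
move=> a b c.
rewrite (zgmulw (msuppD_le a b) (fsubset_refl (msupp c))).
rewrite (zgmulw (fsubsetUl (msupp a) (msupp b)) (fsubset_refl (msupp c))).
rewrite (zgmulw (fsubsetUr (msupp a) (msupp b)) (fsubset_refl (msupp c))).
rewrite -big_split /=; apply/eq_bigr=> g _.
rewrite -big_split /=; apply/eq_bigr=> h _.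
by rewrite mcD mulrDl -/(U _ _) UD.
Qed.

Let zgmulDr : right_distributive zgmul +%R.
Proof.
move=> c a b.
rewrite (zgmulw (fsubset_refl (msupp c)) (msuppD_le a b)).
rewrite (zgmulw (fsubset_refl (msupp c)) (fsubsetUl (msupp a) (msupp b))).
rewrite (zgmulw (fsubset_refl (msupp c)) (fsubsetUr (msupp a) (msupp b))).
rewrite -big_split /=; apply/eq_bigr=> g _.
rewrite -big_split /=; apply/eq_bigr=> h _.
by rewrite mcD mulrDr -/(U _ _) UD.
Qed.

Let zgmul0l : left_zero 0 zgmul.
Proof. by move=> a; rewrite /zgmul [msupp _]msupp0 big_seq_fset0. Qed.

Let zgmul0r : right_zero 0 zgmul.
Proof.
move=> a; rewrite /zgmul big1 // => g _.
by rewrite [msupp _]msupp0 big_seq_fset0.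
Qed.

Lemma zgmulUU g h (x y : int) :
  zgmul (mkmalgU g x) (mkmalgU h y) = mkmalgU (g * h)%g (x * y).
Proof. by rewrite (zgmulw msuppU_le msuppU_le) !big_seq_fset1 !mcoeffUU. Qed.

Let zgmul_suml (I : Type) (r : seq I) (F : I -> ZG) b :
  zgmul (\sum_(i <- r) F i) b = \sum_(i <- r) zgmul (F i) b.
Proof.
exact: (big_morph (zgmul^~ b) (fun x y => zgmulDl x y b) (zgmul0l b)).
Qed.

Let zgmul_sumr (I : Type) (r : seq I) (F : I -> ZG) b :
  zgmul b (\sum_(i <- r) F i) = \sum_(i <- r) zgmul b (F i).
Proof. exact: (big_morph (zgmul b) (fun x y => zgmulDr b x y) (zgmul0r b)). Qed.

Let zgmul1l : left_id zgone zgmul.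
Proof.
move=> a; rewrite {1}[a]zgE zgmul_sumr [RHS]zgE.
by apply/eq_bigr=> g _; rewrite zgmulUU mul1r mul1g.
Qed.

Let zgmul1r : right_id zgone zgmul.
Proof.
move=> a; rewrite {1}[a]zgE zgmul_suml [RHS]zgE.
by apply/eq_bigr=> g _; rewrite zgmulUU mulr1 mulg1.
Qed.

Let zgmulA : associative zgmul.
Proof.
move=> a b c; rewrite [a]zgE !zgmul_suml; apply: eq_bigr => g _.
rewrite [b]zgE zgmul_sumr !zgmul_suml zgmul_sumr; apply: eq_bigr => h _.
rewrite [c]zgE !zgmul_sumr; apply: eq_bigr => k _.
by rewrite !zgmulUU mulrA mulgA.
Qed.

Let zgone_neq0 : zgone != 0.
Proof.
apply/eqP=> /(congr1 (mcoeff (1%g : G))) /eqP.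
by rewrite mcoeffUU [X in _ == X]mcoeff0 oner_eq0.
Qed.

HB.instance Definition _ := GRing.Zmodule_isNzRing.Build (zgroup_ring G)
  zgmulA zgmul1l zgmul1r zgmulDl zgmulDr zgone_neq0.

Lemma zgeltM g h : zgelt (g * h)%g = zgelt g * zgelt h.
Proof. by rewrite [RHS]zgmulUU mul1r. Qed.

Lemma zgelt1 : zgelt 1%g = 1. Proof. by []. Qed.

End GroupRing.

(* The free product of A and B as the set of reduced words: sequences of
   nontrivial letters of A and B in which no two neighbours come from the same
   factor. The product concatenates two words and reduces the result. *)
Section FreeProduct.
Variables A B : groupType.
Local Notation letter := (A + B)%type.
Implicit Types (l : letter) (u v w : seq letter).

Definition fp_triv l :=
  match l with inl a => a == 1%g | inr b => b == 1%g end.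

Definition fp_left l := if l is inl _ then true else false.

Definition fp_inv l : letter :=
  match l with inl a => inl a^-1%g | inr b => inr b^-1%g end.

(* Only meaningful for letters of the same factor. *)
Definition fp_merge l l' : letter :=
  match l, l' with
  | inl a, inl a' => inl (a * a')%g
  | inr b, inr b' => inr (b * b')%g
  | _, _ => l
  end.

Definition fp_reduced w :=
  all (fun l => ~~ fp_triv l) w
  && sorted (fun l l' => fp_left l != fp_left l') w.

Definition fp_push l w : seq letter :=
  if fp_triv l then w else
  if w is l' :: w' then
    if fp_left l == fp_left l' then
      if fp_triv (fp_merge l l') then w' else fp_merge l l' :: w'
    else l :: w
  else [:: l].

Definition fp_mulw u v := foldr fp_push v u.

Definition fp_invw w := rev [seq fp_inv l | l <- w].

Lemma fp_reduced_cons l w :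
  fp_reduced (l :: w) =
  [&& ~~ fp_triv l, fp_reduced w &
      (if w is l' :: _ then fp_left l != fp_left l' else true)].
Proof.
rewrite /fp_reduced; case: w => [|l' w] /=; first by rewrite !andbT.
by rewrite -!andbA; do !bool_congr; rewrite andbC.
Qed.

Lemma fp_left_merge l l' : fp_left (fp_merge l l') = fp_left l.
Proof. by case: l l' => [a|b] [a'|b']. Qed.

Lemma fp_push_reduced l w : fp_reduced w -> fp_reduced (fp_push l w).
Proof.
move=> rw; rewrite /fp_push; case: ifPn => // tl.
case: w rw => [_|l' w rw]; first by rewrite fp_reduced_cons tl.
case: ifPn => [/eqP ell'|nll']; last by rewrite fp_reduced_cons tl rw.
move: rw; rewrite fp_reduced_cons => /and3P[tl' rw hw].
by case: ifPn => // tm; rewrite fp_reduced_cons tm rw fp_left_merge ell'.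
Qed.

Lemma fp_push_id l w : fp_reduced (l :: w) -> fp_push l w = l :: w.
Proof.
rewrite fp_reduced_cons /fp_push => /and3P[/negPf-> _].
by case: w => [|l' w] // /negPf->.
Qed.

Lemma fp_push_merge l l' w : fp_left l = fp_left l' -> fp_reduced w ->
  fp_push l (fp_push l' w) = fp_push (fp_merge l l') w.
Proof.
move=> ell' rw.
case: (boolP (fp_triv l)) => tl.
  have -> : fp_merge l l' = l'.
    by case: l l' ell' tl => [a|b] [a'|b'] //= _ /eqP->; rewrite mul1g.
  by rewrite /fp_push tl.
case: (boolP (fp_triv l')) => tl'.
  have -> : fp_merge l l' = l.
    by case: l l' ell' tl' {tl} => [a|b] [a'|b'] //= _ /eqP->; rewrite mulg1.
  by congr fp_push; rewrite /fp_push tl'.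
rewrite {2}/fp_push (negPf tl').
case: w rw => [_|k w rw].
  rewrite /fp_push (negPf tl) ell' eqxx.
  by case: ifPn.
move: (rw); rewrite fp_reduced_cons => /and3P[tk rw' hw].
case: ifPn => [/eqP el'k|nl'k]; last first.
  rewrite {1}/fp_push (negPf tl) ell' eqxx /fp_push.
  by rewrite fp_left_merge ell' (negPf nl'k); case: ifPn.
have mergeA : fp_merge l (fp_merge l' k) = fp_merge (fp_merge l l') k.
  by case: l l' k ell' el'k {tl tl' rw tk hw} => [a|b] [a'|b'] [x|y] //= _ _;
     rewrite mulgA.
case: ifPn => [tl'k|ntl'k].
  have e : fp_merge (fp_merge l l') k = l.
    rewrite -mergeA; case: l l' k ell' el'k tl'k {tl tl' rw tk hw mergeA}
      => [a|b] [a'|b'] [x|y] //= _ _ /eqP->; by rewrite mulg1.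
  rewrite {2}/fp_push fp_left_merge ell' el'k eqxx e (negPf tl).
  case: ifPn => [tll'|_].
    suff <- : l = k by rewrite fp_push_id // fp_reduced_cons tl rw' ell' el'k.
    rewrite -e; case: l l' k ell' el'k tll' {tl tl' rw tk hw mergeA tl'k e}
      => [a|b] [a'|b'] [x|y] //= _ _ /eqP->; by rewrite mul1g.
  rewrite fp_push_id // fp_reduced_cons tl rw' ell' el'k /=; exact: hw.
rewrite {1}/fp_push (negPf tl) fp_left_merge ell' eqxx mergeA.
rewrite /fp_push fp_left_merge ell' el'k eqxx.
case: (boolP (fp_triv (fp_merge l l'))) => // tll'.
have -> : fp_merge (fp_merge l l') k = k.
  case: l l' k ell' el'k tll' {tl tl' rw tk hw mergeA ntl'k}
    => [a|b] [a'|b'] [x|y] //= _ _ /eqP->; by rewrite mul1g.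
by rewrite (negPf tk).
Qed.

Lemma fp_mulw_reduced u v : fp_reduced v -> fp_reduced (fp_mulw u v).
Proof. by move=> rv; elim: u => //= l u IH; apply: fp_push_reduced. Qed.

Lemma fp_mulw_push l v w : fp_reduced v -> fp_reduced w ->
  fp_mulw (fp_push l v) w = fp_push l (fp_mulw v w).
Proof.
move=> rv rw; rewrite {1}/fp_push.
case: ifPn => tl; first by rewrite /fp_push tl.
case: v rv => [|l' v rv] //.
case: ifPn => [/eqP ell'|_] //=.
rewrite fp_push_merge ?fp_mulw_reduced //.
by case: ifPn => // tm; rewrite /fp_push tm.
Qed.

Lemma fp_mulwA u v w : fp_reduced v -> fp_reduced w ->
  fp_mulw u (fp_mulw v w) = fp_mulw (fp_mulw u v) w.
Proof.
move=> rv rw; elim: u => //= l u ->.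
by rewrite fp_mulw_push // fp_mulw_reduced.
Qed.

Lemma fp_mulw0 u : fp_reduced u -> fp_mulw u [::] = u.
Proof.
elim: u => //= l u IH rlu; rewrite IH ?fp_push_id //.
by move: rlu; rewrite fp_reduced_cons => /and3P[].
Qed.

Lemma fp_triv_inv l : fp_triv (fp_inv l) = fp_triv l.
Proof. by case: l => x /=; rewrite invg_eq1. Qed.

Lemma fp_left_inv l : fp_left (fp_inv l) = fp_left l.
Proof. by case: l. Qed.

Lemma fp_invw_reduced w : fp_reduced w -> fp_reduced (fp_invw w).
Proof.
case/andP=> aw sw; apply/andP; split.
  rewrite /fp_invw all_rev all_map; apply: sub_all aw => l /=.
  by rewrite fp_triv_inv.
rewrite /fp_invw rev_sorted sorted_map.
by apply: sub_sorted sw => l l' /=; rewrite !fp_left_inv eq_sym.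
Qed.

Lemma fp_invwK : involutive fp_invw.
Proof.
move=> w; rewrite /fp_invw map_rev revK -map_comp map_id_in // => l _ /=.
by case: l => x /=; rewrite invgK.
Qed.

Lemma fp_mulVw w : fp_reduced w -> fp_mulw (fp_invw w) w = [::].
Proof.
elim: w => //= l w IH rlw.
rewrite /fp_invw /= rev_cons /fp_mulw foldr_rcons -/(fp_mulw _ _).
move: rlw; rewrite fp_reduced_cons => /and3P[tl rw _].
suff -> : fp_push (fp_inv l) (l :: w) = w by exact: IH.
rewrite /fp_push fp_triv_inv (negPf tl) fp_left_inv eqxx.
by case: l {tl} => x /=; rewrite mulVg eqxx.
Qed.

Record free_product := FreeProduct {
  fp_word :> seq (A + B);
  fp_wordP : fp_reduced fp_word
}.

HB.instance Definition _ := [isSub for fp_word].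
HB.instance Definition _ := [Choice of free_product by <:].

Implicit Types x y z : free_product.

Definition fp_one : free_product := FreeProduct (isT : fp_reduced [::]).

Definition fp_mul x y : free_product :=
  FreeProduct (fp_mulw_reduced x (fp_wordP y)).

Definition fp_invg x : free_product :=
  FreeProduct (fp_invw_reduced (fp_wordP x)).

Let fp_mulA : associative fp_mul.
Proof. by move=> x y z; apply/val_inj/fp_mulwA; apply: fp_wordP. Qed.

Let fp_mul1 : left_id fp_one fp_mul.
Proof. by move=> x; apply/val_inj. Qed.

Let fp_mul1r : right_id fp_one fp_mul.
Proof. by move=> x; apply/val_inj/fp_mulw0/fp_wordP. Qed.

Let fp_mulV : left_inverse fp_one fp_invg fp_mul.
Proof. by move=> x; apply/val_inj/fp_mulVw/fp_wordP. Qed.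

Let fp_mulVr : right_inverse fp_one fp_invg fp_mul.
Proof.
move=> x; apply/val_inj; rewrite /= -{1}[fp_word x]fp_invwK.
exact/fp_mulVw/fp_invw_reduced/fp_wordP.
Qed.

HB.instance Definition _ := isGroup.Build free_product
  fp_mulA fp_mul1 fp_mul1r fp_mulV fp_mulVr.

End FreeProduct.

(* In option nat, None stands for infinity. *)
Definition enat_lt (m n : option nat) : bool :=
  match m, n with
  | Some i, Some j => (i < j)%N
  | Some _, None => true
  | None, _ => false
  end.

Definition enat_min (m n : option nat) : option nat :=
  if enat_lt m n then m else n.

Definition has_order (G : groupType) (x : G) (n : option nat) : Prop :=
  match n with
  | Some s => [/\ (0 < s)%N, (x ^+ s = 1)%g
                & forall k, (0 < k < s)%N -> (x ^+ k <> 1)%g]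
  | None => forall k, (0 < k)%N -> (x ^+ k <> 1)%g
  end.

Definition cyclic_of_order (G : groupType) (n : option nat) : Prop :=
  exists x : G, has_order x n
    /\ forall y : G, exists k : nat, (y = x ^+ k)%g \/ (y = x ^- k)%g.

Definition is_subgroup (G : groupType) (S : G -> Prop) : Prop :=
  [/\ S 1%g, (forall x y, S x -> S y -> S (x * y)%g)
           & (forall x, S x -> S x^-1%g)].

Definition has_subgroup_isog (G K : groupType) : Prop :=
  exists (S : G -> Prop) (f : {multiplicative K -> G}),
    [/\ is_subgroup S, injective f & forall x, S x <-> exists k, f k = x].

Definition zero_divisor_pair (G : groupType) (a b : zgroup_ring G) : Prop :=
  [/\ a <> 0, b <> 0 & a * b = 0].

Definition trivial_pair (G : groupType) (a b : zgroup_ring G) : Prop :=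
  exists (x y : zgroup_ring G) (h : G) (s : nat),
    [/\ (1 < s)%N, has_order h (Some s)
      & (a = x * (1 - zgelt h) /\ b = (\sum_(i < s) zgelt (h ^+ i)%g) * y)
        \/ (a = x * (\sum_(i < s) zgelt (h ^+ i)%g) /\ b = (1 - zgelt h) * y)].

(* Main.v *)
(** If [(A, B)] is trivial, witnessed by [h] of order [s] with norm
    [N_h = 1 + h + ... + h^(s-1)], then either [A N_h = 0] and [h B = B], or
    [A h = A].

    For a finite noncyclic subgroup [K] with sum [N_K], take [A = |K| - N_K]
    and [B = N_K]. Here [A h = A] forces [h = 1], while [h B = B] forces [h] to
    lie in [K], and then [A N_h = |K| N_h - s N_K] is nonzero off [<h>].

    For [C_q * C_r], let [c] generate a finite factor of order [q > 1], let [d]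
    generate the other one, and let [N] be the norm of [c]. The pair [1 - c, N]
    is twisted by the bicyclic unit [u = 1 + 3 (1 - c) d N], with inverse
    [1 - 3 (1 - c) d N], into [A = (1 - c) u] and [B = u^-1 N]. Comparing
    coefficients, [A h = A] forces [h = 1], while [h B = B] forces [h] to lie in
    [<c>] and in [d <c> d^-1], which intersect trivially. *)

Require Import Defs.
From mathcomp Require Import all_boot all_order all_algebra all_fingroup.
From mathcomp Require Import all_solvable.
From HB Require Import structures.
From mathcomp Require Import finmap zify.
From mathcomp.multinomials Require Import monalg.

Set Implicit Arguments.
Unset Strict Implicit.
Unset Printing Implicit Defensive.

Import GRing.Theory Num.Theory.

(** * Coefficients of elements of the group ring *)

Section GroupRing.
Local Open Scope ring_scope.
Variable G : groupType.
Local Notation ZG := (zgroup_ring G).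
Implicit Types (a b : ZG) (g h x : G).

(** A copy of [mcoeff] with source [zgroup_ring], so that additivity can be declared for the
    structure used here. *)
Definition zgcoef x a : int := mcoeff x a.

Fact zgcoef_is_zmod_morphism x : zmod_morphism (zgcoef x).
Proof. by move=> a b; exact: mcoeffB. Qed.

HB.instance Definition _ x :=
  GRing.isZmodMorphism.Build ZG int (zgcoef x) (zgcoef_is_zmod_morphism x).

Lemma zgcoef_elt x g : zgcoef x (zgelt g) = (g == x)%:R.
Proof. by rewrite /zgcoef mcoeffU; case: eqP. Qed.

Lemma zgcoef1 x : zgcoef x 1 = (1%g == x)%:R.
Proof. exact: zgcoef_elt. Qed.

Lemma zgsumE a : a = \sum_(g <- msupp a) zgelt g *~ zgcoef g a.
Proof.
rewrite [LHS]monalgE; apply: eq_bigr => g _.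
have mkz : {morph (fun z : int => mkmalgU g z : ZG) : x y / x - y}.
  by move=> y z; rewrite /= monalgUB.
pose f := GRing.isZmodMorphism.Build int ZG _ mkz.
pose F : {additive int -> ZG} := HB.pack (fun z : int => mkmalgU g z : ZG) f.
by rewrite -[in LHS](intz (mcoeff g a)); apply: (raddfMz F).
Qed.

Lemma zgcoef_eltMl x g a : zgcoef x (zgelt g * a) = zgcoef (g^-1 * x)%g a.
Proof.
rewrite [a]zgsumE mulr_sumr !raddf_sum; apply: eq_bigr => h _ /=.
rewrite mulrzAr -zgeltM !raddfMz /= !zgcoef_elt.
by rewrite -(inj_eq (mulgI g^-1%g)) mulKg.
Qed.

Lemma zgcoef_eltMr x g a : zgcoef x (a * zgelt g) = zgcoef (x * g^-1)%g a.
Proof.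
rewrite [a]zgsumE mulr_suml !raddf_sum; apply: eq_bigr => h _ /=.
rewrite mulrzAl -zgeltM !raddfMz /= !zgcoef_elt.
by rewrite -(inj_eq (mulIg g^-1%g)) mulgK.
Qed.

Lemma zgcoef_sum_inj (I : finType) (f : I -> G) x : injective f ->
  zgcoef x (\sum_i zgelt (f i)) = [exists i, f i == x]%:R.
Proof.
move=> inj_f; rewrite raddf_sum /=.
case: existsP => [[i /eqP <-]|nex].
  rewrite (bigD1 i) //= zgcoef_elt eqxx big1 ?addr0 // => j ji.
  by rewrite zgcoef_elt (inj_eq inj_f) (negPf ji).
rewrite big1 // => i _; rewrite zgcoef_elt; case: eqP => // e.
by case: nex; exists i; apply/eqP.
Qed.

(** * Norms of elements of finite order, and what triviality of a pair implies *)

Definition zgnorm h (s : nat) : ZG := \sum_(i < s) zgelt (h ^+ i)%g.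

(** Multiplication by [h] shifts the terms cyclically: the last one becomes [h ^+ s = 1]. *)
Lemma zgnormMl h s : (h ^+ s = 1)%g -> zgelt h * zgnorm h s = zgnorm h s.
Proof.
case: s => [|s] hs; rewrite /zgnorm; first by rewrite big_ord0 mulr0.
rewrite mulr_sumr big_ord_recr big_ord_recl /= -zgeltM -expgS hs expg0 addrC.
by congr (_ + _); apply: eq_bigr => i _; rewrite -zgeltM -expgS.
Qed.

Lemma zgnormMr h s : (h ^+ s = 1)%g -> zgnorm h s * zgelt h = zgnorm h s.
Proof.
move=> hs; rewrite -[RHS](zgnormMl hs) mulr_suml mulr_sumr.
by apply: eq_bigr => i _; rewrite -!zgeltM -expgS expgSr.
Qed.

Lemma has_order_neq1 h s : (1 < s)%N -> has_order h (Some s) -> h <> 1%g.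
Proof. by move=> s1 [_ _ /(_ 1%N s1)]; rewrite expg1. Qed.

Lemma has_order_expg_inj h s : has_order h (Some s) ->
  injective (fun i : 'I_s => h ^+ i)%g.
Proof.
case=> _ _ ordh i j; wlog le_ij : i j / (i <= j)%N.
  by move=> W e; case/orP: (leq_total i j) => /W-> //.
move=> /= e; apply/val_inj/eqP; rewrite eqn_leq le_ij /= leqNgt.
apply/negP => lt_ij; apply: (ordh (j - i)%N).
  by rewrite subn_gt0 lt_ij (leq_ltn_trans (leq_subr _ _)).
by apply: (mulgI (h ^+ i)%g); rewrite -expgD subnKC // mulg1 -e.
Qed.

(** The norm of [h] absorbs [h], hence is annihilated by [1 - h]. Eliminating the unknown cofactors
    leaves conditions that can be tested on coefficients. *)
Lemma trivial_pair_stab a b : trivial_pair a b ->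
  exists h s, [/\ (1 < s)%N, has_order h (Some s)
    & (a * zgnorm h s = 0 /\ zgelt h * b = b) \/ a * zgelt h = a].
Proof.
move=> [x [y [h [s [s1 oh]]]]]; have [_ hs _] := oh.
rewrite -/(zgnorm h s) => -[[-> ->]|[-> _]]; exists h, s; split=> //.
  left; rewrite mulrA zgnormMl //; split=> //.
  by rewrite -mulrA mulrBl mul1r zgnormMl // subrr mulr0.
by right; rewrite -mulrA zgnormMr.
Qed.

(** * Finite noncyclic subgroups *)

Lemma finite_noncyclic_pair (K : finGroupType) (f : UMagmaMorphism.type K G) :
  ~~ cyclic [set: K] -> injective f ->
  exists a b : ZG, zero_divisor_pair a b /\ ~ trivial_pair a b.
Proof.
move=> ncK inj_f; pose NK : ZG := \sum_(k : K) zgelt (f k).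
have K1 : (1 < #|K|)%N.
  rewrite ltnNge -cardsT; apply: contra ncK => /card_le1_trivg ->.
  exact: cyclic1.
have NKl k : zgelt (f k) * NK = NK.
  rewrite mulr_sumr [RHS](reindex_inj (mulgI k)).
  by apply: eq_bigr => i _; rewrite -zgeltM gmulfM.
have NKr k : NK * zgelt (f k) = NK.
  rewrite mulr_suml [RHS](reindex_inj (mulIg k)).
  by apply: eq_bigr => i _; rewrite -zgeltM gmulfM.
have cNK x : zgcoef x NK = [exists k, f k == x]%:R by apply: zgcoef_sum_inj.
have cNKf k : zgcoef (f k) NK = 1.
  by rewrite cNK; case: existsP => // -[]; exists k.
have cNK1 : zgcoef 1%g NK = 1 by rewrite -(gmulf1 (s := f)) cNKf.
pose A : ZG := #|K|%:R - NK.
have cA x : zgcoef x A = (1%g == x)%:R *+ #|K| - zgcoef x NK.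
  by rewrite raddfB raddfMn /= zgcoef1.
(* At [h] the left side has coefficient [#|K| - 1 > 0], while for [h] other than 1 the right side
   has 0 or -1. *)
have stabA h : A * zgelt h = A -> h = 1%g.
  move=> /(congr1 (zgcoef h)); rewrite zgcoef_eltMr mulgV !cA cNK1 eqxx cNK.
  by case: eqP => // _; case: [exists k, _]; rewrite /= natz mul0rn;
    move: K1; set m := #|K|; lia.
exists A, NK; split; first split.
- by move/(congr1 (zgcoef 1%g)); rewrite cA cNK1 eqxx raddf0 natz;
    move: K1; set m := #|K|; lia.
- by move/(congr1 (zgcoef 1%g)); rewrite cNK1 raddf0.
- rewrite mulrBl mulr_natl {2}/NK mulr_sumr.
  by rewrite (eq_bigr (fun=> NK)) ?sumr_const ?subrr.
move=> /trivial_pair_stab[h [s [s1 oh]]].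
case=> [[AN hN]|/stabA]; last exact: has_order_neq1 oh.
(* The coefficient of [zgelt h * NK] at [h] is that of [NK] at 1, namely 1. *)
have /existsP[k /eqP fk] : [exists k, f k == h].
  move/(congr1 (zgcoef h)): hN; rewrite zgcoef_eltMl mulVg cNK1 cNK.
  by case: [exists k, _].
have [k' k'N] : exists k', k' \notin <[k]>%g.
  apply/existsP; apply: contraR ncK => /existsPn sub.
  apply/cyclicP; exists k; apply/setP => i; rewrite inE.
  by have := sub i; rewrite negbK.
have NKN : NK * zgnorm h s = NK *+ s.
  rewrite mulr_sumr (eq_bigr (fun=> NK)) ?sumr_const ?card_ord // => i _.
  by rewrite -fk -gmulfXn NKr.
(* Since [f k'] is not a power of [h], only [- NK *+ s] contributes, and the coefficient is [-s],
   not 0. *)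
move/(congr1 (zgcoef (f k'))): AN; rewrite mulrBl mulr_natl NKN raddf0 raddfB.
rewrite !raddfMn /= cNKf (zgcoef_sum_inj _ (has_order_expg_inj oh)).
case: existsP => [[i /eqP]|_]; last by lia.
rewrite -fk -gmulfXn => /inj_f e.
by move/negP: k'N; case; rewrite -e mem_cycle.
Qed.

(** * Twisting the pair [1 - c], [N] by a bicyclic unit *)

Lemma twisted_norm_pair (c d : G) (q : nat) :
    (1 < q)%N -> has_order c (Some q) ->
    (forall i j, c ^+ i * d = d * c ^+ j -> c ^+ i = 1)%g ->
  exists a b : ZG, zero_divisor_pair a b /\ ~ trivial_pair a b.
Proof.
move=> q1 oc disj; have [q0 cq _] := oc.
have c1 := has_order_neq1 q1 oc.
(* [n] is the indicator function of [<c>]; the coefficients of [T] and [B] are expressed through it.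
   The hypothesis [disj] says that [<c>] meets its conjugate by [d] trivially. *)
pose N := zgnorm c q; pose n x := zgcoef x N.
have nE x : n x = [exists i : 'I_q, c ^+ i == x]%g%:R.
  by apply: zgcoef_sum_inj; apply: has_order_expg_inj.
have nP x : (n x = 0) \/ (n x = 1 /\ exists i, (c ^+ i)%g = x).
  rewrite nE; case: existsP => [[i /eqP e]|_]; last by left.
  by right; split=> //; exists i.
have n1 : n 1%g = 1.
  by rewrite nE; case: existsP => // -[]; exists (Ordinal q0).
have cN : zgelt c * N = N by apply: zgnormMl.
have ncl x : n (c^-1 * x)%g = n x by rewrite /n -zgcoef_eltMl cN.
have ncr x : n (x * c^-1)%g = n x by rewrite /n -zgcoef_eltMr zgnormMr.
have cV : (c^-1 = c ^+ q.-1)%g.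
  by apply: (mulgI c); rewrite -expgS prednK // mulgV cq.
(* If [d^-1] were a power of [c], then [d] would commute with [c], and [disj] with both exponents 1
   would give [c = 1]. *)
have ndV : n d^-1%g = 0.
  case: (nP d^-1%g) => // -[_ [i e]]; case: c1; rewrite -(expg1 c).
  apply: (disj 1%N 1%N); apply: (mulgI d^-1%g); apply: (mulIg d^-1%g).
  by rewrite expg1 mulKg mulgA mulgK -e -expgS -expgSr.
have nd : n d = 0.
  case: (nP d) => // -[_ [i e]]; case: c1; rewrite -(expg1 c).
  by apply: (disj 1%N 1%N); rewrite -e -expgD -expgD addnC.
have nJ : n (d^-1 * (c^-1 * d))%g = 0.
  case: (nP (d^-1 * (c^-1 * d))%g) => // -[_ [i e]].
  have /disj : (c ^+ q.-1 * d = d * c ^+ i)%g by rewrite e mulKVg cV.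
  by rewrite -cV => /eqP; rewrite invg_eq1 => /eqP.
pose C := 1 - zgelt c; pose T := C * zgelt d * N.
have CN : C * N = 0 by rewrite mulrBl mul1r cN subrr.
have NC : N * C = 0 by rewrite mulrBr mulr1 zgnormMr // subrr.
have NN : N * N = N *+ q.
  rewrite {1}/N mulr_suml (eq_bigr (fun=> N)) ?sumr_const ?card_ord // => i _.
  elim: (i : nat) => [|j IH]; first by rewrite mul1r.
  by rewrite expgS zgeltM -mulrA IH.
(* Modulo 3 the element [A] is [1 - c]; 3 is the least modulus for which -1 differs from both 0 and
   1, as the last comparison requires. *)
pose A := C * (1 + T *+ 3); pose B := (1 - T *+ 3) * N.
have AB : A * B = 0.
  (* The product [N * C = 0] occurs in the middle of [T * T], so [1 + T *+ 3] and [1 - T *+ 3] are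
     inverse to each other. *)
  have TT : T * T = 0.
    by rewrite /T -!mulrA (mulrA N) NC mul0r !mulr0.
  rewrite /A /B -mulrA (mulrA (1 + _)).
  have -> : (1 + T *+ 3) * (1 - T *+ 3) = 1.
    rewrite mulrDl mul1r mulrBr mulr1 mulrnAl mulrnAr TT !mul0rn subr0.
    by rewrite subrK.
  by rewrite mul1r.
have cT x : zgcoef x T = n (d^-1 * x)%g - n (d^-1 * (c^-1 * x))%g.
  by rewrite /T -mulrA mulrBl mul1r raddfB /= !zgcoef_eltMl.
have cB x : zgcoef x B
    = n x - (n (d^-1 * x)%g - n (d^-1 * (c^-1 * x))%g) *+ (3 * q).
  rewrite /B mulrBl mul1r mulrnAl -mulrA NN mulrnAr -mulrnA.
  by rewrite raddfB raddfMn /= cT mulnC.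
have [t cA] : exists t : G -> int, forall x,
    zgcoef x A = (1%g == x)%:R - (c == x)%:R + t x *+ 3.
  exists (fun x => zgcoef x (C * T)) => x.
  by rewrite /A mulrDr mulr1 raddfD raddfB mulrnAr raddfMn /= zgcoef_elt zgcoef1.
have cAc : zgcoef c A = -1.
  have cCT x : zgcoef x (C * T) = zgcoef x T - zgcoef (c^-1 * x)%g T.
    by rewrite mulrBl mul1r raddfB /= zgcoef_eltMl.
  rewrite /A mulrDr mulr1 raddfD raddfB mulrnAr raddfMn /= zgcoef_elt zgcoef1.
  rewrite eqxx cCT !cT mulVg !mulg1.
  have -> : n (d^-1 * c)%g = 0 by rewrite -ncr mulgK.
  by rewrite ncr ndV; case: eqP => [/esym/c1|].
have cB1 : zgcoef 1%g B = 1.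
  by rewrite cB !mulg1 n1 ncr ndV subr0 mul0rn subr0.
have cBd : zgcoef d B = - (3 * q)%:R.
  by rewrite cB nd nJ mulVg n1 subr0 sub0r.
exists A, B; split; first split => //.
- by move/(congr1 (zgcoef c)); rewrite cAc raddf0.
- by move/(congr1 (zgcoef 1%g)); rewrite cB1 raddf0.
move=> /trivial_pair_stab[h [s [s1 oh]]] stab.
apply: (has_order_neq1 s1 oh); case: stab => [[_ hB]|Ah].
  (* The coefficient of [B] at [h] equals that at 1, which is 1; modulo 3 it is [n h]. *)
  have [i hi] : exists i, (c ^+ i = h)%g.
    case: (nP h) => [nh|[] //].
    move/(congr1 (zgcoef h)): hB; rewrite zgcoef_eltMl mulVg cB1 cB nh.
    by set u := (_ - _); lia.
  (* The coefficient of [B] at [h * d] equals that at [d], which is [-3q]. If [n (d^-1 * (h * d))]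
     vanished, it would be nonnegative. *)
  have [j hj] : exists j, (c ^+ j = d^-1 * (h * d))%g.
    case: (nP (d^-1 * (h * d))%g) => [nh|[] //].
    move/(congr1 (zgcoef (h * d)%g)): hB; rewrite zgcoef_eltMl mulKg cBd cB nh.
    by case: (nP (h * d)%g) => [|[]] ->;
       case: (nP (d^-1 * (c^-1 * (h * d)))%g) => [|[]] ->; lia.
  by rewrite -hi; apply: (disj i j); rewrite hj mulKVg hi.
(* The coefficient of [A] at [c * h] is then -1; unless [h = 1], it is 0 or 1 modulo 3. *)
move/(congr1 (zgcoef (c * h)%g)): Ah; rewrite zgcoef_eltMr mulgK cAc cA.
case: (c =P (c * h)%g) => [e _|_]; first by apply: (mulgI c); rewrite mulg1.
by case: (1%g == _); lia.
Qed.

End GroupRing.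

(** * One-letter elements of the free product *)

Section FreeProduct.
Local Open Scope group_scope.
Variables A B : groupType.

(** Pushing onto the empty word sends a trivial letter to the empty word, so the map is total and
    multiplicative on each factor. *)
Definition fp_letter (l : A + B) : free_product A B :=
  FreeProduct (fp_push_reduced l (isT : fp_reduced [::])).

Lemma fp_letterM (l l' : A + B) : fp_left l = fp_left l' ->
  fp_letter l * fp_letter l' = fp_letter (fp_merge l l').
Proof.
move=> ll'; apply: val_inj.
by rewrite /= fp_mulw_push ?fp_push_reduced //= fp_push_merge.
Qed.

Lemma fp_letter_expg (l : A + B) k :
  fp_letter l ^+ k =
  fp_letter (match l with inl a => inl (a ^+ k) | inr b => inr (b ^+ k) end).
Proof.
elim: k => [|k IH].
  by apply: val_inj; case: l => x; rewrite /= /fp_push /= expg0 eqxx.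
by rewrite expgS IH fp_letterM; case: l {IH} => x //=; rewrite expgS.
Qed.

Lemma fp_letter_eq1 (l : A + B) : (fp_letter l == 1) = fp_triv l.
Proof.
by rewrite -val_eqE /= /fp_push; case: ifP.
Qed.

Lemma has_order_fp_letter (l : A + B) q :
  match l with inl a => has_order a (Some q) | inr b => has_order b (Some q) end ->
  has_order (fp_letter l) (Some q).
Proof.
case: l => x [q0 xq ordx]; split=> // [|k /ordx xk];
  rewrite fp_letter_expg.
- by apply/eqP; rewrite fp_letter_eq1 /= xq.
- by move/eqP; rewrite fp_letter_eq1 => /eqP.
- by apply/eqP; rewrite fp_letter_eq1 /= xq.
- by move/eqP; rewrite fp_letter_eq1 => /eqP.
Qed.

(** If the power of [l] were nontrivial, the left side would be a reduced word starting in the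
    factor of [l], while the right side starts with [m]. This supplies the hypothesis [disj]. *)
Lemma fp_letter_conj (l m : A + B) i j : fp_left l != fp_left m ->
  ~~ fp_triv m ->
  fp_letter l ^+ i * fp_letter m = fp_letter m * fp_letter l ^+ j ->
  fp_letter l ^+ i = 1.
Proof.
move=> lm tm; rewrite !fp_letter_expg => /(congr1 val) /=.
case: l m lm tm => x [] y //= _ ty; rewrite /fp_push /= (negPf ty) /=.
  have [e _|xi] := eqVneq (x ^+ i) 1.
    by apply/eqP; rewrite fp_letter_eq1 /= e.
  by case: eqP => _ /=; rewrite /fp_push /= (negPf xi) ?(negPf ty).
have [e _|xi] := eqVneq (x ^+ i) 1.
  by apply/eqP; rewrite fp_letter_eq1 /= e.
by case: eqP => _ /=; rewrite /fp_push /= (negPf xi) ?(negPf ty).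
Qed.

End FreeProduct.

(** * Transfer to [G] and choice of the two generators *)

Lemma has_order_gt1 (G : groupType) (x : G) n :
  enat_lt (Some 1) n -> has_order x n -> x != 1%g.
Proof.
by move=> n1 ox; apply/eqP => x1; case: n n1 ox => [m m1 [_ _]|_] /(_ 1);
  rewrite x1 expg1n => /(_ _ erefl); apply.
Qed.

(** Letters [l] and [m] of opposite factors stand for the two generators, so that either factor may
    be the finite one. *)
Lemma free_product_pair (G : groupType) (A B : groupType)
    (f : UMagmaMorphism.type (free_product A B) G) (l m : A + B) q :
    injective f -> fp_left l != fp_left m -> ~~ fp_triv m -> 1 < q ->
    match l with inl a => has_order a (Some q) | inr b => has_order b (Some q) end ->
  exists a b : zgroup_ring G, zero_divisor_pair a b /\ ~ trivial_pair a b.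
Proof.
move=> inj_f lm tm q1 /has_order_fp_letter [q0 lq ordl].
apply: (twisted_norm_pair (c := f (fp_letter l)) (d := f (fp_letter m)) q1) => //.
  split=> //; first by rewrite -gmulfXn lq gmulf1.
  by move=> k /ordl lk; rewrite -gmulfXn -(gmulf1 (s := f)) => /inj_f.
move=> i j; rewrite -!gmulfXn -!gmulfM => /inj_f.
by move/fp_letter_conj => -> //; rewrite gmulf1.
Qed.

(** A multiplicative map between groups preserves 1 by cancellation; the unital structure gives
    access to [gmulf1] and [gmulfXn]. *)
Lemma has_subgroup_isog_morphism (G K : groupType) : has_subgroup_isog G K ->
  exists f : UMagmaMorphism.type K G, injective f.
Proof.
move=> [_ [f [_ inj_f _]]].
have f1 : f 1%g = 1%g by apply: (mulgI (f 1%g)); rewrite -gmulfM !mulg1.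
pose m := Multiplicative_isUMagmaMorphism.Build K G f f1.
by exists (HB.pack (Multiplicative.sort f) m : UMagmaMorphism.type K G).
Qed.

Theorem theorem2 (G : groupType) :
  (exists K : finGroupType, ~~ cyclic [set: K] /\ has_subgroup_isog G K)
  \/ (exists (q r : option nat) (C D : groupType),
        [/\ cyclic_of_order C q, cyclic_of_order D r,
            enat_lt (Some 1%N) (enat_min q r) /\ enat_lt (enat_min q r) None
          & has_subgroup_isog G (free_product C D)]) ->
  exists a b : zgroup_ring G, zero_divisor_pair a b /\ ~ trivial_pair a b.
Proof.
case=> [[K [ncK /has_subgroup_isog_morphism[f inj_f]]]|].
  exact: finite_noncyclic_pair inj_f.
move=> [q [r [C [D [[x [ox _]] [y [oy _]] [min1 minoo]]]]]].
move=> /has_subgroup_isog_morphism[f inj_f].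
have [q1 r1] : enat_lt (Some 1) q /\ enat_lt (Some 1) r.
  by case: q r {ox oy} min1 minoo => [q|] [r|] //=; rewrite /enat_min /=;
    case: ifP => //=; lia.
have x1 := has_order_gt1 q1 ox; have y1 := has_order_gt1 r1 oy.
case: q ox q1 min1 minoo => [q|] ox q1 min1 minoo.
  by apply: (free_product_pair inj_f (l := inl x) (m := inr y)) ox.
(* With [q] infinite, finiteness of the minimum forces [r] to be finite, and the factors exchange
   roles. *)
case: r oy r1 min1 minoo => [r|] // oy r1 _ _.
by apply: (free_product_pair inj_f (l := inr y) (m := inl x)) oy.
Qed.
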